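(* For every $n \geq 1$, $\gamma(Q^3_n) \leq n\cdot\gamma(Q^2_n)$, and moreover $n \cdot \gamma(Q^2_n) \leq \tfrac{69}{133}n^2 + O(n)$ as $n \to \infty$.
   Context: $[n] = \{0,1,\ldots,n-1\}$. The 3D queen graph $Q^3_n$ has vertex set $[n]^3$; distinct $v,w$ are adjacent iff $w-v$ is a nonzero integer multiple of one of $(1,0,0),(0,1,0),(0,0,1)$, $(1,\pm1,0),(1,0,\pm1),(0,1,\pm1)$, $(1,\pm1,\pm1)$. The 2D queen graph $Q^2_n$ has vertex set $[n]^2$; distinct $v,w$ are adjacent iff $w-v$ is a nonzero integer multiple of one of $(1,0),(0,1),(1,1),(1,-1)$. A set $S$ of vertices of a graph is dominating if every vertex is in $S$ or adjacent to a vertex of $S$; $\gamma(G)$ is the minimum size of a dominating set of $G$. *)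

(* Defs.v *)
From HB Require Import structures.
From mathcomp Require Export all_boot all_order all_algebra.
From mathcomp Require Export boolp.

Set Implicit Arguments.
Unset Strict Implicit.
Unset Printing Implicit Defensive.

Import Order.TTheory GRing.Theory Num.Theory.
Local Open Scope ring_scope.

Definition dominating (T : finType) (adj : T -> T -> Prop) (S : {set T}) : Prop :=
  forall v : T, v \in S \/ exists2 u : T, u \in S & adj u v.

(* The default set [set: T] is always dominating, so the minimum is attained. *)
Definition gamma (T : finType) (adj : T -> T -> Prop) : nat :=
  #|[arg min_(S < [set: T] | `[< dominating adj S >]) #|S| ]|.

Definition coord2 (n : nat) (v : 'I_n * 'I_n) : int * int :=
  ((v.1 : nat)%:Z, (v.2 : nat)%:Z).

Definition coord3 (n : nat) (v : 'I_n * 'I_n * 'I_n) : int * int * int :=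
  ((v.1.1 : nat)%:Z, (v.1.2 : nat)%:Z, (v.2 : nat)%:Z).

Definition dirs2 : seq (int * int) :=
  [:: (1, 0); (0, 1); (1, 1); (1, -1)].

Definition dirs3 : seq (int * int * int) :=
  [:: (1, 0, 0); (0, 1, 0); (0, 0, 1);
      (1, 1, 0); (1, -1, 0); (1, 0, 1); (1, 0, -1); (0, 1, 1); (0, 1, -1);
      (1, 1, 1); (1, 1, -1); (1, -1, 1); (1, -1, -1)].

Definition queen2 (n : nat) (v w : 'I_n * 'I_n) : Prop :=
  v <> w /\ exists d : int * int, exists k : int,
    [/\ d \in dirs2, k <> 0 & coord2 w - coord2 v = d *~ k].

Definition queen3 (n : nat) (v w : 'I_n * 'I_n * 'I_n) : Prop :=
  v <> w /\ exists d : int * int * int, exists k : int,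
    [/\ d \in dirs3, k <> 0 & coord3 w - coord3 v = d *~ k].

Definition gammaQ2 (n : nat) : nat := gamma (@queen2 n).
Definition gammaQ3 (n : nat) : nat := gamma (@queen3 n).

(* Main.v *)
Require Import Defs.
From mathcomp Require Import all_boot all_order all_algebra.
From mathcomp Require Import zify ring lra.

Set Implicit Arguments.
Unset Strict Implicit.
Unset Printing Implicit Defensive.

Import Order.TTheory GRing.Theory Num.Theory.
Local Open Scope ring_scope.

(** The first bound holds because n parallel copies of a dominating set of Q^2_n
    dominate Q^3_n.

    For the second, centre the board and put all queens on squares (2 X, 2 Y).
    Occupying all even columns and rows leaves only the odd-odd squares, which
    must be hit diagonally; a square with halved difference D and halved sum S
    satisfies |D| + |S| <= r on the board [-r, r]^2, and D, S have opposite
    parities. So it suffices to occupy the diagonals with D even, |D| <= d0, or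
    D odd, |D| <= d1, and likewise for S, where d0 + d1 is about r. The
    parallelogram law sum (D^2 + S^2) = 2 sum (X^2 + Y^2) forces d0 and d1 to be
    quite different for an economical solution; 113 queens achieve this with
    d0 = 84, d1 = 25 and |X|, |Y| <= 54.

    Such a finite solution is blown up by a factor m = 6 t + 1: a queen (X, Y)
    becomes the m queens (m X + 2 i, m Y + 2 j) with j = 2 i + const mod m.
    Steps of 2 preserve the parity classes, the windows of length 2 m tile each
    class of columns, rows and differences, and the sums are also covered, up to
    an end effect, because 3 is invertible mod m. With m queens added in two
    corners this gives gamma(Q^2_(220 m - 1)) <= 114 m, and 114 / 220 < 69 / 133.
    Intermediate sizes follow from gamma(Q^2_(n+1)) <= gamma(Q^2_n) + 1, one
    corner queen covering the new row and the new column. *)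

(** * Minimum dominating sets and the bound for [Q^3_n] *)

Section Domination.
Context (T : finType) (adj : T -> T -> Prop).

Lemma dominating_setT : dominating adj [set: T].
Proof. by move=> v; left; rewrite inE. Qed.

Lemma gamma_le (S : {set T}) : dominating adj S -> (gamma adj <= #|S|)%N.
Proof.
move=> domS; rewrite /gamma.
case: arg_minnP => [|A _]; first exact/asboolP/dominating_setT.
by apply; exact/asboolP.
Qed.

Lemma gamma_attained : exists2 S : {set T}, dominating adj S & #|S| = gamma adj.
Proof.
rewrite /gamma; case: arg_minnP => [|A /asboolP domA _].
  exact/asboolP/dominating_setT.
by exists A.
Qed.

End Domination.

Lemma fst_mulrz (U V : zmodType) (d : U * V) (k : int) : (d *~ k).1 = d.1 *~ k.
Proof. exact: (raddfMz fst). Qed.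

Lemma snd_mulrz (U V : zmodType) (d : U * V) (k : int) : (d *~ k).2 = d.2 *~ k.
Proof. exact: (raddfMz snd). Qed.

Lemma gammaQ3_le (n : nat) : (gammaQ3 n <= n * gammaQ2 n)%N.
Proof.
have [S domS cardS] := gamma_attained (@queen2 n).
rewrite /gammaQ2 -cardS mulnC -[n in (_ * n)%N]card_ord -cardsT -cardsX.
apply: gamma_le => -[v z].
have [vS | [u uS [uv [d [k [d_dir k0 def_d]]]]]] := domS v.
  by left; rewrite in_setX vS inE.
right; exists (u, z); first by rewrite in_setX uS inE.
split=> [[/uv]//|]; exists (d.1, d.2, 0), k; split=> //.
  by case: d d_dir {def_d} => a b; rewrite !inE !xpair_eqE !eqxx !andbT !andbF /=;
     case/or4P => ->; rewrite ?orbT.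
move: def_d => /[dup] /(congr1 fst) d1 /(congr1 snd) d2.
apply: injective_projections; last by rewrite snd_mulrz /= subrr mul0rz.
rewrite fst_mulrz; apply: injective_projections.
  by rewrite fst_mulrz [RHS]/= -fst_mulrz -d1.
by rewrite snd_mulrz [RHS]/= -snd_mulrz -d2.
Qed.

(** * Queen lines on a centred board; enlarging the board *)

Definition aligned (p q : int * int) : bool :=
  [|| p.1 == q.1, p.2 == q.2, p.2 - p.1 == q.2 - q.1 | p.1 + p.2 == q.1 + q.2].

Lemma aligned_queen2 (n : nat) (v w : 'I_n * 'I_n) :
  v <> w -> aligned (coord2 v) (coord2 w) -> queen2 v w.
Proof.
case: v w => [a b] [c e] neq al; split=> //.
have {}neq : (a : nat)%:Z <> (c : nat) \/ (b : nat)%:Z <> (e : nat).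
  have [eac | nac] := eqVneq a c; [right => eb | left => ea].
    by apply: neq; rewrite eac; congr (_, _); apply/val_inj/eqP; rewrite -eqz_nat eb.
  by move/eqP: nac; apply; apply/val_inj/eqP; rewrite -eqz_nat ea.
have step (d : int * int) (k : int) : d \in dirs2 -> k <> 0 ->
    (c : nat)%:Z - (a : nat)%:Z = d.1 * k -> (e : nat)%:Z - (b : nat)%:Z = d.2 * k ->
    exists d : int * int, exists k : int,
    [/\ d \in dirs2, k <> 0 & coord2 (c, e) - coord2 (a, b) = d *~ k].
  move=> dd k0 h1 h2; exists d, k; split=> //.
  by apply: injective_projections; rewrite ?fst_mulrz ?snd_mulrz mulrzz.
rewrite /aligned /= in al.
move: (step (0, 1) ((e : nat)%:Z - (b : nat)%:Z)) (step (1, 0) ((c : nat)%:Z - (a : nat)%:Z))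
  (step (1, 1) ((c : nat)%:Z - (a : nat)%:Z)) (step (1, -1) ((c : nat)%:Z - (a : nat)%:Z)).
rewrite /= => {step} s1 s2 s3 s4.
case/or4P: al => /eqP h; [apply: s1|apply: s2|apply: s3|apply: s4] => //; lia.
Qed.

(** Translation by [r] centres the board; repetitions in [P] only lower the cardinality. *)
Lemma gammaQ2_le_size (r : nat) (P : seq (int * int)) :
  {in P, forall p : int * int, `|p.1| <= r%:Z /\ `|p.2| <= r%:Z} ->
  (forall q : int * int, `|q.1| <= r%:Z -> `|q.2| <= r%:Z -> has (aligned ^~ q) P) ->
  (gammaQ2 r.*2.+1 <= size P)%N.
Proof.
move=> Pin Pdom.
pose g (p : int * int) : 'I_r.*2.+1 * 'I_r.*2.+1 :=
  (inord (absz (p.1 + r%:Z)), inord (absz (p.2 + r%:Z))).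
have gE (p : int * int) : p \in P ->
    coord2 (g p) = (p.1 + r%:Z, p.2 + r%:Z).
  move=> /Pin[p1 p2]; rewrite /coord2 /g /=.
  by rewrite !inordK; [congr (_, _); lia | lia | lia].
apply: (@leq_trans #|[set:: [seq g p | p <- P]]|); last first.
  by rewrite cardsE (leq_trans (card_size _)) // size_map.
apply: gamma_le => v.
have /hasP[p pP al] := Pdom ((v.1 : nat)%:Z - r%:Z, (v.2 : nat)%:Z - r%:Z)
  ltac:(move: (ltn_ord v.1) => /=; lia) ltac:(move: (ltn_ord v.2) => /=; lia).
have gpS : g p \in [set:: [seq g p | p <- P]] by rewrite inE map_f.
have [<-|/eqP gv] := eqVneq (g p) v; first by left.
right; exists (g p) => //; apply: aligned_queen2 => //.
by move: al; rewrite gE // /aligned /=; lia.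
Qed.

Lemma gammaQ2S (n : nat) : (gammaQ2 n.+1 <= (gammaQ2 n).+1)%N.
Proof.
have [S domS cardS] := gamma_attained (@queen2 n).
pose up (v : 'I_n * 'I_n) := (widen_ord (leqnSn n) v.1, widen_ord (leqnSn n) v.2).
have upE v : coord2 (up v) = coord2 v by [].
rewrite /gammaQ2 -cardS.
apply: (@leq_trans #|(ord_max, ord_max) |: up @: S|); last first.
  by rewrite (leq_trans (leq_card_setU _ _)) // cards1 add1n ltnS leq_imset_card.
apply: gamma_le => -[a b].
have [->|nab] := eqVneq (a, b) (ord_max, ord_max); first by left; rewrite !inE eqxx.
have [edge | inner] := boolP ((a == n :> nat) || (b == n :> nat)).
  right; exists (ord_max, ord_max); first by rewrite !inE eqxx.
  apply: aligned_queen2; first by move/esym/eqP; rewrite (negPf nab).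
  by move: edge; rewrite /aligned /=; lia.
have ltan : (a < n)%N by move: (ltn_ord a) inner; lia.
have ltbn : (b < n)%N by move: (ltn_ord b) inner; lia.
have -> : (a, b) = up (Ordinal ltan, Ordinal ltbn) by congr (_, _); apply: val_inj.
have [vS | [u uS [uv [d [k [dd k0 def_d]]]]]] := domS (Ordinal ltan, Ordinal ltbn).
  by left; rewrite !inE imset_f ?orbT.
right; exists (up u); first by rewrite !inE imset_f ?orbT.
split; last by exists d, k.
by move=> [e1 e2]; apply: uv;
   case: u {uS def_d} e1 e2 => [u1 u2] /= e1 e2; congr (_, _); apply: val_inj.
Qed.

Lemma gammaQ2D (n c : nat) : (gammaQ2 (n + c) <= gammaQ2 n + c)%N.
Proof.
elim: c => [|c IHc]; first by rewrite !addn0.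
by rewrite !addnS (leq_trans (gammaQ2S _)).
Qed.

(** * Windows of step 2 and the modular queens pattern *)

Lemma centered_div (h d : int) : 0 <= h ->
  exists e i : int, d = (2 * h + 1) * e + i /\ `|i| <= h.
Proof.
move=> h0; exists ((d + h) %/ (2 * h + 1))%Z, (((d + h) %% (2 * h + 1))%Z - h).
move: (divz_eq (d + h) (2 * h + 1)).
have := modz_ge0 (d + h) (_ : 2 * h + 1 != 0).
have := ltz_pmod (d + h) (_ : 0 < 2 * h + 1).
by lia.
Qed.

(** As [2 h + 1] is odd, the window of index [X] lies in the parity class of [X]; the windows of
    indices [X] and [X + 2] are adjacent there. *)
Lemma parity_tile (h T : int) : 0 <= h ->
  exists X i : int, [/\ T = (2 * h + 1) * X + 2 * i, `|i| <= h & (2 %| T - X)%Z].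
Proof.
move=> h0; have [e [i [de ih]]] := centered_div ((T - (2 * h + 1) * (T %% 2)%Z) %/ 2)%Z h0.
exists ((T %% 2)%Z + 2 * e), i; split=> //; last by lia.
have : (2 %| T - (2 * h + 1) * (T %% 2)%Z)%Z.
  have [T2|T2] : (T %% 2)%Z = 0 \/ (T %% 2)%Z = 1 by lia.
    by rewrite T2; lia.
  by rewrite T2; lia.
set u := (2 * h + 1) * (T %% 2)%Z in de *; move=> u2.
have : T - u = 2 * ((2 * h + 1) * e + i) by rewrite -de; lia.
by rewrite /u; lia.
Qed.

(* Modulo [2 h + 1] this is [2 i + h], so that [(i, knight h i)] is the
   classical modular queens pattern. *)
Definition knight (h i : int) : int := if i <= 0 then 2 * i + h else 2 * i - h - 1.

Lemma knight_bound (h i : int) : `|i| <= h -> `|knight h i| <= h.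
Proof. by rewrite /knight; case: ifP; lia. Qed.

Lemma knight_row (h j : int) : `|j| <= h -> exists2 i : int, `|i| <= h & knight h i = j.
Proof.
move=> jh; have [jh2 | jh2] := boolP (2 %| j - h)%Z.
  by exists ((j - h) %/ 2)%Z; rewrite /knight; [|case: ifP]; lia.
by exists ((j + h + 1) %/ 2)%Z; rewrite /knight; [|case: ifP]; lia.
Qed.

(** The difference is [i + h] for [i <= 0] and [i - h - 1] for [i > 0]: the two branches fill
    [[0, h]] and [[-h, -1]]. *)
Lemma knight_diff (h d : int) : `|d| <= h ->
  exists2 i : int, `|i| <= h & knight h i - i = d.
Proof.
move=> dh; have [d0 | d0] := lerP 0 d.
  by exists (d - h); rewrite /knight; [|case: ifP]; lia.
by exists (d + h + 1); rewrite /knight; [|case: ifP]; lia.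
Qed.

(* Needs 3 invertible modulo [m = 6 t + 1]; its inverse is [- 2 t]. *)
Lemma knight_sum (t T : int) : 0 <= t -> let m := 6 * t + 1 in
  exists S i : int, [/\ `|i| <= 3 * t, T = m * S + 2 * (i + knight (3 * t) i),
    (2 %| T - S)%Z & `|i + knight (3 * t) i| < m].
Proof.
move=> t0 m.
have h0 : 0 <= 3 * t by lia.
have [X [tau [defT _ TX]]] := parity_tile T h0.
(* Modulo [m] the sum [i + knight (3 * t) i] is [3 i + 3 t], and it has to be [tau]. The excess
   multiple of [2 m] then shifts [X] by an even number. *)
have [e [i [di ih]]] := centered_div (- (2 * t) * (tau - 3 * t)) h0.
have [w kn] : exists w : int, knight (3 * t) i = 2 * i + 3 * t + m * w.
  by rewrite /knight; case: ifP => _; [exists 0 | exists (-1)]; rewrite /m; lia.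
have mE : 2 * (3 * t) + 1 = m by rewrite /m; lia.
rewrite mE in defT di.
exists (X + 2 * (tau - 3 * t + 3 * e - w)), i; split=> //.
- have di' : i = - (2 * t) * (tau - 3 * t) - m * e by rewrite di; ring.
  by rewrite kn defT di' /m; ring.
- by lia.
- by rewrite /knight; case: ifP; rewrite /m; lia.
Qed.

(** * Cell covers and their blow-up *)

Definition reach (d0 d1 T : int) : int := if (2 %| T)%Z then d0 else d1.

(** The reach of [T] has the parity of [T]. *)
Lemma reach_gt (d0 d1 T : int) : (2 %| d0)%Z -> ~~ (2 %| d1)%Z ->
  reach d0 d1 T < `|T| -> reach d0 d1 T + 2 <= `|T|.
Proof. by rewrite /reach; case: ifP; lia. Qed.

(* A cell (X, Y) stands for the square (2 X, 2 Y) of a centred board. An odd-odd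
   square has halved difference and sum of opposite parities, so that it is one
   of [d0], [d1] that bounds the former and the other that bounds the latter. *)
Record cell_cover (L : nat) (d0 d1 : int) (B : seq (int * int)) : Prop := CellCover {
  cover_even : (2 %| d0)%Z;
  cover_odd : ~~ (2 %| d1)%Z;
  cover_reach : d0 + d1 = 2 * L%:Z - 1;
  cover_in : forall c : int * int, c \in B -> `|c.1| < L%:Z /\ `|c.2| < L%:Z;
  cover_col : forall X : int, `|X| < L%:Z -> exists2 c, c \in B & c.1 = X;
  cover_row : forall Y : int, `|Y| < L%:Z -> exists2 c, c \in B & c.2 = Y;
  cover_diff : forall D : int, `|D| <= reach d0 d1 D ->
    exists2 c, c \in B & c.2 - c.1 = D;
  cover_sum : forall S : int, `|S| <= reach d0 d1 S ->
    exists2 c, c \in B & c.1 + c.2 = S }.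

Definition irange (h : nat) : seq int := [seq k%:Z - h%:Z | k <- iota 0 h.*2.+1].

Lemma mem_irange (h : nat) (i : int) : (i \in irange h) = (`|i| <= h%:Z).
Proof.
apply/mapP/idP => [[k]|ih]; first by rewrite mem_iota => kh ->; lia.
by exists (absz (i + h%:Z)); [rewrite mem_iota|]; lia.
Qed.

Definition blow (t : nat) (c : int * int) (i : int) : int * int :=
  let m := 6 * t%:Z + 1 in
  (2 * (m * c.1 + 2 * i), 2 * (m * c.2 + 2 * knight (3 * t%:Z) i)).

(** Twice a point in the inner half of the window of index [L]. Used for both coordinates, it serves
    a column and a row at once. *)
Definition corner (L t k : nat) : int := 2 * ((6 * t%:Z + 1) * L%:Z - 2 * k%:Z).

Definition blowup (L t : nat) (B : seq (int * int)) : seq (int * int) :=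
  [seq blow t c i | c <- B, i <- irange (3 * t)] ++
  [seq (corner L t k, corner L t k) | k <- iota 1 (3 * t)] ++
  [seq (- corner L t k, - corner L t k) | k <- iota 1 (3 * t)].

Lemma size_blowup (L t : nat) (B : seq (int * int)) :
  (size (blowup L t B) <= (size B).+1 * (6 * t + 1))%N.
Proof.
rewrite !size_cat size_allpairs !size_map !size_iota.
by rewrite (_ : (3 * t).*2.+1 = 6 * t + 1)%N; lia.
Qed.

Lemma blow_in (L t : nat) (B : seq (int * int)) (c : int * int) (i : int) :
  c \in B -> `|i| <= 3 * t%:Z -> blow t c i \in blowup L t B.
Proof.
move=> cB ih; rewrite mem_cat; apply/orP; left.
by apply: allpairs_f => //; rewrite mem_irange; lia.
Qed.

(* Cells with index of absolute value below [L] leave, in the parity class of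
   [L], a half window uncovered at each end: the corner queens take care of it. *)
Lemma line_cover (L t : nat) (T : int) : `|T| < (6 * t%:Z + 1) * L%:Z ->
  (exists X i : int, [/\ T = (6 * t%:Z + 1) * X + 2 * i, `|i| <= 3 * t%:Z
    & `|X| < L%:Z]) \/
  (exists2 k : nat, k \in iota 1 (3 * t) &
    2 * T = corner L t k \/ 2 * T = - corner L t k).
Proof.
move=> TL; have h0 : 0 <= 3 * t%:Z by lia.
have [X [i [defT ih _]]] := parity_tile T h0.
rewrite (_ : 2 * (3 * t%:Z) + 1 = 6 * t%:Z + 1) in defT; last by lia.
have [XL | LX] := ltrP `|X| L%:Z; first by left; exists X, i.
right; have [eX|eX] : X = L%:Z \/ X = - L%:Z.
- suff : `|X| < L%:Z + 1 by lia.
  by nia.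
- exists (absz i); first by rewrite mem_iota; subst X; nia.
  by left; rewrite /corner; subst X; nia.
- exists (absz i); first by rewrite mem_iota; subst X; nia.
  by right; rewrite /corner; subst X; nia.
Qed.

Lemma gammaQ2_blowup (L t : nat) (d0 d1 : int) (B : seq (int * int)) :
  (0 < L)%N -> cell_cover L d0 d1 B ->
  (gammaQ2 (4 * (6 * t + 1) * L).-1 <= (size B).+1 * (6 * t + 1))%N.
Proof.
move=> L0 [d0e d1o dL Bin Bcol Brow Bdiff Bsum].
apply: leq_trans (size_blowup L t B).
have -> : (4 * (6 * t + 1) * L).-1 = (2 * ((6 * t + 1) * L)).-1.*2.+1 by lia.
have rE : (2 * ((6 * t + 1) * L)).-1%:Z = 2 * ((6 * t%:Z + 1) * L%:Z) - 1 by lia.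
set m := 6 * t%:Z + 1 in rE *.
have m0 : 0 < m by lia.
apply: gammaQ2_le_size => [p|[x y] /=]; rewrite rE.
  rewrite !mem_cat => /or3P[/allpairsP[[c i] [/= /Bin[c1 c2]]]|/mapP[k]|/mapP[k]].
  - rewrite mem_irange => ih ->.
    have kh : `|knight (3 * t%:Z) i| <= 3 * t%:Z by apply: knight_bound; lia.
    by rewrite /blow /= -/m; split; nia.
  - by rewrite mem_iota => k1 -> /=; rewrite /corner -/m; split; nia.
  - by rewrite mem_iota => k1 -> /=; rewrite /corner -/m; split; nia.
move=> xr yr.
have corner_in (k : nat) : k \in iota 1 (3 * t) ->
    ((corner L t k, corner L t k) \in blowup L t B) *
    ((- corner L t k, - corner L t k) \in blowup L t B).
  by move=> kt; rewrite !mem_cat; split; apply/or3P;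
     [apply: Or32 | apply: Or33]; apply/mapP; exists k.
have [x2 | x2] := boolP (2 %| x)%Z.
  have [|[X [i [defX ih /Bcol[c cB cX]]]]|[k /corner_in kt defx]] := @line_cover L t (x %/ 2)%Z.
  - by lia.
  - apply/hasP; exists (blow t c i); first exact: blow_in.
    by apply/or4P/Or41/eqP; rewrite /= cX -defX; lia.
  case: defx => defx; apply/hasP.
    by exists (corner L t k, corner L t k); rewrite ?kt //;
       apply/or4P/Or41/eqP; rewrite /= -defx; lia.
  by exists (- corner L t k, - corner L t k); rewrite ?kt //;
     apply/or4P/Or41/eqP; rewrite /= -defx; lia.
have [y2 | y2] := boolP (2 %| y)%Z.
  have [|[Y [j [defY jh /Brow[c cB cY]]]]|[k /corner_in kt defy]] := @line_cover L t (y %/ 2)%Z.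
  - by lia.
  - have [i ih kn] := knight_row jh.
    apply/hasP; exists (blow t c i); first exact: blow_in.
    by apply/or4P/Or42/eqP; rewrite /= cY kn -defY; lia.
  case: defy => defy; apply/hasP.
    by exists (corner L t k, corner L t k); rewrite ?kt //;
       apply/or4P/Or42/eqP; rewrite /= -defy; lia.
  by exists (- corner L t k, - corner L t k); rewrite ?kt //;
     apply/or4P/Or42/eqP; rewrite /= -defy; lia.
have [D' defD'] : exists D' : int, y - x = 2 * D' by exists ((y - x) %/ 2)%Z; lia.
have [S' defS'] : exists S' : int, x + y = 2 * S' by exists ((x + y) %/ 2)%Z; lia.
have h0 : 0 <= 3 * t%:Z by lia.
have [D [d [defD dh D2]]] := parity_tile D' h0.
rewrite (_ : 2 * (3 * t%:Z) + 1 = m) in defD; last by lia.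
have [Dr | /(reach_gt d0e d1o) Dr] := lerP `|D| (reach d0 d1 D).
  have [c cB cD] := Bdiff D Dr; have [i ih kn] := knight_diff dh.
  apply/hasP; exists (blow t c i); first exact: blow_in.
  by apply/or4P/Or43/eqP; rewrite /= -/m defD' defD -cD -kn; ring.
have [|S [i [ih defS S2 sm]]] := @knight_sum t%:Z S'; first by lia.
rewrite -/m in defS sm.
have [Sr | /(reach_gt d0e d1o) Sr] := lerP `|S| (reach d0 d1 S).
  have [c cB cS] := Bsum S Sr.
  apply/hasP; exists (blow t c i); first exact: blow_in.
  by apply/or4P/Or44/eqP; rewrite /= -/m defS' defS -cS; ring.
(* Each reach is exceeded by at least 2, so a missed square would have [|D| + |S| >= 2 L + 3]. *)
have reachDS : reach d0 d1 D + reach d0 d1 S = 2 * L%:Z - 1.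
  have -> : reach d0 d1 S = reach d1 d0 D; last first.
    by rewrite -dL /reach; case: ifP => _ //; rewrite addrC.
  have yE : y = D' + S' by clear -defD' defS'; lia.
  have DS : (2 %| S)%Z = ~~ (2 %| D)%Z by move: y2 D2 S2; clear -yE; lia.
  by rewrite /reach DS; case: (2 %| D)%Z.
(* Here [|D'| + |S'|] is the maximum of [|x|] and [|y|], below [2 m L], and the window offsets
   contribute less than [m] and [2 m]. *)
have : m * (`|D| + `|S|) < m * (2 * L%:Z + 3).
  have normM (T : int) : m * `|T| = `|m * T| by rewrite normrM (gtr0_norm m0).
  rewrite mulrDr !normM.
  have -> : m * D = D' - 2 * d by rewrite defD addrK.
  have -> : m * S = S' - 2 * (i + knight (3 * t%:Z) i) by rewrite defS addrK.
  rewrite [ltRHS]mulrDr [m * (2 * _)]mulrCA.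
  by lia.
rewrite ltr_pM2l //.
by lia.
Qed.

(** * An explicit cover by 113 cells and the resulting density *)

(* Found by computer search. Each [(a, b)] stands for an orbit under the
   quarter turn; the entries cover [1..54], and the sums and differences cover
   the even numbers up to 84 and the odd numbers up to 25. *)
Definition base_orbits : seq (nat * nat) :=
  [:: (33, 51); (30, 52); (36, 44); (31, 45); (38, 40); (24, 48); (35, 39);
      (25, 28); (20, 50); (21, 47); (23, 43); (19, 29); (15, 27); (26, 32);
      (3, 37); (18, 34); (10, 54); (7, 53); (8, 46); (14, 42); (13, 49);
      (2, 17); (4, 5); (6, 11); (9, 41); (9, 16); (1, 22); (1, 12)]%N.

Definition base : seq (int * int) :=
  (0, 0) :: flatten [seq
    let a := p.1%:Z in let b := p.2%:Z in [:: (a, b); (- b, a); (- a, - b); (b, - a)]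
    | p <- base_orbits].

Lemma all_irange (h : nat) (P : pred int) :
  all P (irange h) -> forall T : int, `|T| <= h%:Z -> P T.
Proof. by move=> /allP hP T Th; apply: hP; rewrite mem_irange. Qed.

Lemma has_exists2 (f : int * int -> int) (T : int) :
  has (fun c => f c == T) base -> exists2 c, c \in base & f c = T.
Proof. by case/hasP => c cB /eqP; exists c. Qed.

(** Both reaches are at most 84, so finite ranges suffice and computation decides. *)
Lemma base_cover : cell_cover 55 84 25 base.
Proof.
have reach_le (T : int) : `|T| <= reach 84 25 T -> `|T| <= 84%:Z.
  by rewrite /reach; case: ifP; lia.
split=> //.
- have /allP inB : all (fun c : int * int => (`|c.1| < 55%:Z) && (`|c.2| < 55%:Z)) base.
    by vm_compute.
  by move=> c /inB /andP[].
- have /all_irange colB : all (fun X => has (fun c => c.1 == X) base) (irange 54).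
    by vm_compute.
  by move=> X X55; apply/(@has_exists2 fst)/colB; lia.
- have /all_irange rowB : all (fun Y => has (fun c => c.2 == Y) base) (irange 54).
    by vm_compute.
  by move=> Y Y55; apply/(@has_exists2 snd)/rowB; lia.
- have /all_irange diffB : all (fun D => (`|D| <= reach 84 25 D) ==>
      has (fun c => c.2 - c.1 == D) base) (irange 84) by vm_compute.
  move=> D Dr; apply: (@has_exists2 (fun c => c.2 - c.1)).
  exact: implyP (diffB D (reach_le D Dr)) Dr.
- have /all_irange sumB : all (fun S => (`|S| <= reach 84 25 S) ==>
      has (fun c => c.1 + c.2 == S) base) (irange 84) by vm_compute.
  move=> S Sr; apply: (@has_exists2 (fun c => c.1 + c.2)).
  exact: implyP (sumB S (reach_le S Sr)) Sr.
Qed.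

(** The sizes [220 m - 1] with [m = 6 t + 1] are [219 + 1320 t], needing at most [114 + 684 t]
    queens, and [133 * 684 <= 69 * 1320]. Gaps cost under 1320 more, whence [1434 = 114 + 1320]. *)
Lemma gammaQ2_le (n : nat) : (219 <= n)%N -> (133 * gammaQ2 n <= 69 * n + 133 * 1434)%N.
Proof.
move=> n219; set t := ((n - 219) %/ 1320)%N; set c := ((n - 219) %% 1320)%N.
have nE : (n = (4 * (6 * t + 1) * 55).-1 + c)%N.
  by move: (divn_eq (n - 219) 1320); rewrite -/t -/c; lia.
have c_lt : (c < 1320)%N by rewrite ltn_mod.
have := gammaQ2_blowup t (isT : (0 < 55)%N) base_cover.
have := gammaQ2D (4 * (6 * t + 1) * 55).-1 c.
rewrite -nE (_ : size base = 113%N) //; lia.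
Qed.

Theorem theorem6 :
  (forall n : nat, (1 <= n)%N -> (gammaQ3 n <= n * gammaQ2 n)%N) /\
  (exists (C : rat) (N : nat), forall n : nat, (N <= n)%N ->
     (n * gammaQ2 n)%:R <= 69%:R / 133%:R * n%:R ^+ 2 + C * n%:R :> rat).
Proof.
split=> [n _|]; first exact: gammaQ3_le.
exists 1434%:R, 219%N => n /gammaQ2_le.
rewrite -(ler_nat rat) natrD !natrM => gn.
have n0 : 0 <= n%:R :> rat by rewrite ler0n.
have {}gn : (gammaQ2 n)%:R <= 69%:R / 133%:R * n%:R + 1434%:R :> rat by lra.
by have := ler_wpM2l n0 gn; rewrite expr2; lra.
Qed.
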